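(* Let $k \ge 4$ and let $\tau_k = k\,(k-1)\ldots 4\,2\,1\,3 \in S_k$. Then there exist constants $a, b$, integers $r, s$, and a polynomial $p$ of degree $k-2$ such that for all $n \ge k$, $$|S_n(132, \tau_k, 2341)| = a F_{n+r} + b F_{n+s} + p(n).$$
   Context: Permutations of $[n]$ are written in one-line notation, and $S_n$ denotes the set of them. A permutation $\pi\in S_n$ contains $\sigma\in S_m$ if there are indices $i_1<\dots<i_m$ such that for all $a,b$, $\pi(i_a)<\pi(i_b)$ iff $\sigma(a)<\sigma(b)$; otherwise $\pi$ avoids $\sigma$. For a set $R$ of permutations, $S_n(R)$ is the set of $\pi\in S_n$ avoiding every element of $R$. The permutation $k\,(k-1)\ldots 4\,2\,1\,3$ lists $k,k-1,\dots,4$ in decreasing order followed by $2,1,3$ (e.g. $4213$ for $k=4$, $54213$ for $k=5$). $F_n$ denotes the Fibonacci numbers with $F_0=0$, $F_1=F_2=1$, $F_n=F_{n-1}+F_{n-2}$ (extended to negative indices by the same recurrence if needed). *)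

(* Defs.v *)
From HB Require Import structures.
From mathcomp Require Import all_boot all_order all_algebra all_fingroup.

Set Implicit Arguments.
Unset Strict Implicit.
Unset Printing Implicit Defensive.

(* 'S_n acts on {0, ..., n-1}; the word uses the values 1, ..., n. *)
Definition oneline n (p : 'S_n) : seq nat := [seq (p i).+1 | i <- enum 'I_n].

(* The identity is only a default for words that are not permutations of
   1 ... n; see perm_of_onelineK. *)
Definition perm_of_oneline n (w : seq nat) : 'S_n :=
  odflt 1%g [pick p : 'S_n | oneline p == w].

Lemma perm_of_onelineK n (w : seq nat) :
  perm_eq w (iota 1 n) -> oneline (perm_of_oneline n w) = w.
Proof.
move=> wP; rewrite /perm_of_oneline; case: pickP => [p /eqP //|noP].
have sw : size w = n by rewrite (perm_size wP) size_iota.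
have uw : uniq w by rewrite (perm_uniq wP) iota_uniq.
have wn (i : 'I_n) : 0 < nth 0 w i <= n.
  have : nth 0 w i \in iota 1 n by rewrite -(perm_mem wP) mem_nth ?sw.
  by rewrite mem_iota add1n ltnS.
have wlt (i : 'I_n) : (nth 0 w i).-1 < n.
  by case/andP: (wn i) => w0 wi; rewrite prednK.
have f_inj : injective (fun i : 'I_n => Ordinal (wlt i)).
  move=> i j /(congr1 val) /= /(congr1 succn).
  have [/andP[wi _] /andP[wj _]] := (wn i, wn j).
  rewrite !prednK // => /eqP; rewrite nth_uniq ?sw // => /eqP ij.
  exact: val_inj.
have := noP (perm f_inj); rewrite (_ : oneline _ = w) ?eqxx //.
apply: (@eq_from_nth _ 0); first by rewrite size_map size_enum_ord sw.
move=> i; rewrite size_map size_enum_ord => lin.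
have i0 : 'I_n := Ordinal lin.
rewrite (nth_map i0) ?size_enum_ord // permE /= nth_enum_ord //.
by case/andP: (wn (Ordinal lin)) => w0 _; rewrite prednK.
Qed.

Definition contains n m (p : 'S_n) (q : 'S_m) : bool :=
  [exists f : {ffun 'I_m -> 'I_n},
    [forall a : 'I_m, forall b : 'I_m, (a < b) ==> (f a < f b)] &&
    [forall a : 'I_m, forall b : 'I_m, (p (f a) < p (f b)) == (q a < q b)]].

Definition pattern := {m : nat & 'S_m}.

Definition Pattern m (q : 'S_m) : pattern := Tagged (fun m : nat => 'S_m) q.

Definition avoiders n (R : seq pattern) : {set 'S_n} :=
  [set p : 'S_n | all (fun q : pattern => ~~ contains p (tagged q)) R].

Definition tau_word k : seq nat := rev (iota 4 (k - 3)) ++ [:: 2; 1; 3].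

Lemma tau_word_perm k : 3 <= k -> perm_eq (tau_word k) (iota 1 k).
Proof.
move=> k3; rewrite -{2}(subnKC k3) iotaD perm_catC.
by apply: perm_cat => //; rewrite perm_rev.
Qed.

Definition tau k : 'S_k := perm_of_oneline k (tau_word k).

Definition perm132 : 'S_3 := perm_of_oneline 3 [:: 1; 3; 2].

Definition perm2341 : 'S_4 := perm_of_oneline 4 [:: 2; 3; 4; 1].

Fixpoint fib (n : nat) : nat :=
  match n with
  | 0 => 0
  | 1 => 1
  | (n1.+1 as n2).+1 => fib n2 + fib n1
  end.

(* fib_neg n is F_{-n}, from the recurrence read backwards:
   F_{-(n+2)} = F_{-n} - F_{-(n+1)}. *)
Fixpoint fib_neg (n : nat) : int :=
  match n with
  | 0 => 0%R
  | 1 => 1%R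
  | (n1.+1 as n2).+1 => (fib_neg n1 - fib_neg n2)%R
  end.

Definition fibz (i : int) : int :=
  match i with
  | Posz n => (fib n)%:Z
  | Negz n => fib_neg n.+1
  end.

Lemma fibz_rec (i : int) : fibz (i + 2)%R = (fibz (i + 1) + fibz i)%R.
Proof.
case: i => [n|[|[|n]]] //.
  by rewrite -!PoszD addn2 addn1 /= PoszD.
rewrite [(Negz n.+2 + 2)%R](_ : _ = Negz n); last first.
  by rewrite !NegzE -[n.+3]addn2 PoszD GRing.opprD GRing.addrNK.
rewrite [(Negz n.+2 + 1)%R](_ : _ = Negz n.+1); last first.
  by rewrite !NegzE -[n.+3]addn1 PoszD GRing.opprD GRing.addrNK.
by rewrite /fibz /= [RHS]GRing.addrC GRing.subrK.
Qed.

(* Main.v *)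
Require Import Defs.
From mathcomp Require Import all_boot all_order all_algebra all_fingroup.
From mathcomp Require Import zify ring lra.

(** Write [k = j + 3] and let [num j n] be the number of permutations in
    question.  Avoiding 132 forces a permutation of size [n + 1] to be a word
    [L (n+1) R] with every letter of [L] above every letter of [R].  If [R] is
    empty, [L] is any avoider of size [n] when [j > 0], and is increasing when
    [j = 0].  If [R] is nonempty, avoiding 2341 forces [L] to be decreasing, so
    that [L] is determined by its length [l]; the initial segments of
    [tau k] that [L (n+1)] can supply are then those of length at most
    [min j (max l 1)], so the condition on [R] is to avoid the same pattern with [j] replaced by [j - max l 1] (and
    [l <= 1] when [j = 0]).  Hence [num 0 n = F_(n+2) - 1] for [n > 0], and
    [num j (n+1) - num j n = sum_(l < n) num (j - max l 1) (n - l)] for [j > 0].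
    Sequences [a F_n + b F_(n+1) + p(n)] are stable under shifts and under
    discrete integration, which raises [deg p] by one.  In the difference above
    the polynomial part of top degree comes only from [l = 0] and [l = 1]
    (from the whole sum of [num 0] when [j = 1]), with a negative coefficient,
    so no cancellation occurs and [deg p = j + 1]. *)

Set Implicit Arguments.
Unset Strict Implicit.
Unset Printing Implicit Defensive.

(** * Subsequences of a word and occurrences of patterns *)

Section Subsequences.
Variable T : eqType.
Implicit Types (P : pred (seq T)) (s t w : seq T).

(** Quantifying over masks of the length of [w], a finite type, makes this a boolean. *)
Definition occurs P w : bool :=
  [exists m : (size w).-tuple bool, P (mask m w)].

Lemma occursP P w : reflect (exists2 s, subseq s w & P s) (occurs P w).
Proof.
apply: (iffP existsP) => [[m Pm]|[_ /subseqP[m sm ->] Pm]].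
  by exists (mask m w) => //; apply: mask_subseq.
by exists (Tuple (introT eqP sm)).
Qed.

Lemma subseq_catP s w1 w2 :
  reflect (exists s1 s2, [/\ s = s1 ++ s2, subseq s1 w1 & subseq s2 w2])
          (subseq s (w1 ++ w2)).
Proof.
apply: (iffP idP) => [/subseqP[m sm ->]|[s1 [s2 [-> ? ?]]]]; last exact: cat_subseq.
rewrite -(cat_take_drop (size w1) m) mask_cat; last first.
  by rewrite size_takel // sm size_cat leq_addr.
by do 2!eexists; split; first by []; apply: mask_subseq.
Qed.

Lemma subseq_rcons_rcons s w x y :
  subseq (rcons s x) (rcons w y) ->
  subseq s w /\ (x = y \/ subseq (rcons s x) w).
Proof.
rewrite -[rcons w y]cats1 => /subseq_catP[s1 [s2 [e s1w]]].
case: s2 e => [|z s2] /=.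
  rewrite cats0 => e _; rewrite -e in s1w; split; last by right.
  by apply: subseq_trans s1w; apply: subseq_rcons.
case: (z =P y) => [->|_] e /eqP // s20.
by move: e; rewrite s20 cats1 => /rcons_inj[-> ->]; split; [|left].
Qed.

Lemma pairwise_subseq2 (r : rel T) w :
  (forall x y, subseq [:: x; y] w -> r x y) -> pairwise r w.
Proof.
elim: w => // a w IH H; apply/andP; split.
  by apply/allP => b bw; apply: H; rewrite /= eqxx sub1seq.
by apply: IH => x y xy; apply: H; apply: subseq_trans xy (subseq_cons _ _).
Qed.

End Subsequences.

(** * The three forbidden patterns as predicates on words *)

Local Notation decr := (pairwise gtn).
Local Notation incr := (pairwise ltn).

Definition like132 (s : seq nat) :=
  if s is [:: x; z; y] then x < y < z else false.

Definition like2341 (s : seq nat) :=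
  if s is [:: b; c; d; a] then [&& a < b, b < c & c < d] else false.

(* Recognises the words order-isomorphic to [tau (j + 3)]. *)
Fixpoint like_tau j (s : seq nat) :=
  match j, s with
  | 0, [:: y; x; z] => x < y < z
  | j'.+1, h :: s' => all (gtn h) s' && like_tau j' s'
  | _, _ => false
  end.

Definition good j w :=
  [&& ~~ occurs like132 w, ~~ occurs like2341 w & ~~ occurs (like_tau j) w].

Lemma goodP j w :
  reflect (forall s, subseq s w -> [/\ ~~ like132 s, ~~ like2341 s & ~~ like_tau j s])
          (good j w).
Proof.
apply: (iffP and3P) => [[H1 H2 H3] s sw|H].
  by split; [apply: contra H1|apply: contra H2|apply: contra H3] => Ps;
    apply/occursP; exists s.
by split; apply/negP => /occursP[s /H[/negPf h1 /negPf h2 /negPf h3]];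
  rewrite ?h1 ?h2 ?h3.
Qed.

Lemma good_subseq j s w : subseq s w -> good j w -> good j s.
Proof.
by move=> sw /goodP H; apply/goodP => t ts; apply: H; apply: subseq_trans sw.
Qed.

(** Each leading letter of the pattern dominates all later ones, so the pattern can be cut anywhere
    before its final 213. This serves to cut an occurrence at the border between [L N] and [R]. *)
Lemma like_tau_cat j u s :
  like_tau (size u + j) (u ++ s) = [&& decr u, allrel gtn u s & like_tau j s].
Proof.
elim: u => //= h u IH; rewrite IH all_cat allrel_consl -!andbA.
by do !bool_congr.
Qed.


Lemma like_tau_drop i j s : like_tau (i + j) s -> like_tau j (drop i s).
Proof.
elim: i s => [|i IH] s; first by rewrite drop0.
by case: s => //= h s /andP[_ /IH].
Qed.

Lemma like_tau_incr j s : incr s -> ~~ like_tau j s.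
Proof.
elim: j s => [|j IH] [|h s] //=.
  by case: s => [|? [|? []]] //= ?; lia.
by case/andP=> _ /IH /negPf->; rewrite andbF.
Qed.

(** * Good words around their maximum *)

Lemma good_incr j w : incr w -> good j w.
Proof.
move=> iw; apply/goodP => s sw; have inc_s := subseq_pairwise sw iw.
split; last exact: like_tau_incr.
  by case: s sw inc_s => [|? [|? [|? []]]] //= _; lia.
by case: s sw inc_s => [|? [|? [|? [|? []]]]] //= _; lia.
Qed.

(** For [0 < j] none of the three patterns ends in its largest letter, so a final maximum takes part
    in no occurrence. For [j = 0] the pattern 213 does end in its maximum. *)
Lemma good_rcons j w N : 0 < j -> all (gtn N) w -> good j (rcons w N) = good j w.
Proof.
move=> j0 /allP wN; apply/idP/idP => [|/goodP H].
  exact/good_subseq/subseq_rcons.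
apply/goodP => s sub; have [//|nsw] := boolP (subseq s w); first exact: H.
case/lastP: s => [|s x] in sub nsw *; first by case: j j0 {H}.
have [sw [xN|xsw]] := subseq_rcons_rcons sub; last by rewrite xsw in nsw.
have {}sN y : y \in s -> y < N by move=> ys; apply: wN; apply: (mem_subseq sw).
subst x; split.
- case: s {sub nsw sw} sN => [|x [|y [|? []]]] //= sN.
  by have := sN y; rewrite !inE eqxx orbT => /(_ isT); lia.
- case: s {sub nsw sw} sN => [|x [|y [|? [|? []]]]] //= sN.
  by have := sN x; rewrite !inE eqxx => /(_ isT); lia.
case: j j0 {H} => //= j _; case: s {sub nsw sw} sN => [|h s] //= sN.
  by case: j.
rewrite all_rcons /=; have := sN h; rewrite mem_head => /(_ isT).
by rewrite ltnNge leq_eqVlt => /norP[_ /negPf->].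
Qed.

(** A descent of [w] followed by [N] is an occurrence of 213. *)
Lemma good0_rcons_incr w N :
  uniq w -> all (gtn N) w -> good 0 (rcons w N) -> incr w.
Proof.
move=> uw /allP wN /goodP H; apply: pairwise_subseq2 => x y xy /=.
have /= := subseq_uniq xy uw; rewrite inE andbT => nxy.
have [_ _ /=] : [/\ ~~ like132 [:: x; y; N], ~~ like2341 [:: x; y; N]
                & ~~ like_tau 0 [:: x; y; N]].
  by apply: H; rewrite -cats1 (cat_subseq (s1 := [:: x; y])) //= eqxx.
have /= := wN x; rewrite (mem_subseq xy) ?mem_head //; lia.
Qed.

(** An ascent of [L], then [N], then a letter of [R] is an occurrence of 2341. *)
Lemma good_left_decr j L N R :
  R != [::] -> uniq L -> all (gtn N) L -> allrel gtn L R ->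
  good j (L ++ N :: R) -> decr L.
Proof.
case: R => // r R _ uL /allP LN /allrelP LR /goodP H.
apply: pairwise_subseq2 => x y xy /=.
have /= := subseq_uniq xy uL; rewrite inE andbT => nxy.
have [_ + _] : [/\ ~~ like132 [:: x; y; N; r], ~~ like2341 [:: x; y; N; r]
                & ~~ like_tau j [:: x; y; N; r]].
  by apply: H; rewrite (cat_subseq (s1 := [:: x; y])) //= !eqxx sub0seq.
have xL : x \in L by rewrite (mem_subseq xy) ?mem_head.
have yL : y \in L by rewrite (mem_subseq xy) // !inE eqxx orbT.
have /= := LN _ yL; have /= := LR _ r xL (mem_head _ _); lia.
Qed.

Lemma minnD_subn m n : minn m n + (m - n) = m.
Proof. by lia. Qed.

(** The prefix [D N] can supply the first [maxn (size D) 1] letters of the pattern, or fewer, and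
    [R] must avoid what is left. For [j = 0], two letters of [D] followed by [N] already form
    213. *)
Lemma good_cat j D N R :
  decr D -> all (gtn N) D -> allrel gtn (rcons D N) R ->
  good j (D ++ N :: R) =
  ((0 < j) || (size D <= 1)) && good (j - maxn (size D) 1) R.
Proof.
move=> dD DN DR; rewrite -cat_rcons.
have RDR : subseq R (rcons D N ++ R) by apply: suffix_subseq.
apply/idP/andP => [gw|[j0 gR]].
  split.
    case: j gw => //= /goodP gw; case: D dD DN DR gw {RDR} => [|a [|b D]] //=.
    move=> /andP[/andP[ab _] _] /and3P[aN bN _] _ gw.
    have [|_ _ /=] := gw [:: a; b; N]; last by rewrite ab aN.
    rewrite /= !eqxx sub1seq mem_cat mem_rcons mem_head //.
  have /goodP H := good_subseq RDR gw; move/goodP in gw.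
  apply/goodP => t tR; have [h1 h2 _] := H t tR; split=> //; apply/negP => ht.
  set M := maxn _ _ in ht.
  (* The longest useful decreasing word in [D N]: [D], or [N] alone if [D] is empty, cut to the [j]
     leading letters of the pattern. *)
  pose u := take (minn j M) (if D is [::] then [:: N] else D).
  have szu : size u = minn j M.
    by rewrite size_takel // (leq_trans (geq_minr _ _)) // /M; case: (D) => //=; lia.
  have uDN : subseq u (rcons D N).
    apply: (subseq_trans (take_subseq _ _)).
    by case: (D) => [|a D'] //=; rewrite ?eqxx // subseq_rcons.
  have du : decr u.
    by apply: (subseq_pairwise (take_subseq _ _)); case: (D) dD.
  have [_ _ /negP[]] := gw (u ++ t) (cat_subseq uDN tR).
  have -> : j = size u + (j - M) by rewrite szu minnD_subn.
  rewrite like_tau_cat du ht andbT; apply/allrelP => x y xu yt.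
  by move/allrelP: DR; apply; [apply: (mem_subseq uDN)|apply: (mem_subseq tR)].
apply/goodP => s /subseq_catP[s1 [s2 [-> s1D s2R]]].
have /goodP/(_ _ s2R)[R1 R2 R3] := gR.
have s12 : allrel gtn s1 s2.
  apply/allrelP => x y xs ys; move/allrelP: DR; apply.
    exact: (mem_subseq s1D).
  exact: (mem_subseq s2R).
(* Only the last letter of [s1] can be [N], so a word [s1] of three letters or more begins with two
   letters of [D], hence with a descent. As [s1] lies above [s2], an occurrence of 132 or 2341 not
   inside [R] lies wholly in [s1] or is cut as 234|1; both would make [s1] begin with an ascent. *)
have desc x y z t : s1 = [:: x, y, z & t] -> x > y.
  move=> e; move: s1D; rewrite e (lastI z) -[_ :: _]/([:: x, y & _]) -!rcons_cons.
  case/subseq_rcons_rcons => /subseq_pairwise/(_ dD) /=.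
  by case/andP=> /andP[].
split.
- apply/negP; case: s1 s1D s12 desc => [|a [|b [|c s1]]] _.
  + by rewrite (negPf R1).
  + by case: s2 {s2R R1 R2 R3} => [|? [|? []]] //; rewrite /allrel /=; lia.
  + by case: s2 {s2R R1 R2 R3} => [|? []] //; rewrite /allrel /=; lia.
  move=> _ /(_ _ _ _ _ erefl).
  by case: s1 s2 {s2R R1 R2 R3} => [|? ?] [|? ?] //=; lia.
- apply/negP; case: s1 s1D s12 desc => [|a [|b [|c s1]]] _.
  + by rewrite (negPf R2).
  + by case: s2 {s2R R1 R2 R3} => [|? [|? [|? []]]] //; rewrite /allrel /=; lia.
  + by case: s2 {s2R R1 R2 R3} => [|? [|? []]] //; rewrite /allrel /=; lia.
  move=> _ /(_ _ _ _ _ erefl).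
  by case: s1 s2 {s2R R1 R2 R3} => [|? [|? ?]] [|? [|? ?]] //=; lia.
apply/negP => ht.
have [s1j|js1] := leqP (size s1) j.
  have ej : j = size s1 + (j - size s1) by rewrite subnKC.
  move: ht; rewrite ej like_tau_cat => /and3P[ds1 _ ht].
  (* If the decreasing word [s1] uses [N], it is [N] alone, since any letter before it comes from
     [D] and is smaller; otherwise it is a subsequence of [D]. *)
  have s1M : size s1 <= maxn (size D) 1.
    case/lastP: s1 s1D ds1 {s12 desc s1j ej ht} => // u x.
    case/subseq_rcons_rcons => uD [xN|/size_subseq h _]; last first.
      exact: leq_trans h (leq_maxl _ _).
    case: u uD => [|h u]; first by rewrite leq_maxr.
    move=> /mem_subseq/(_ h (mem_head _ _)) hD.
    rewrite xN /= all_rcons /= => /andP[/andP[Nh _] _].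
    by have /= := allP DN _ hD; rewrite ltnNge (ltnW Nh).
  (* When [s1] is shorter than the supply of [D N], [s2] carries extra leading letters; dropping [i]
     of them leaves the pattern that [R] avoids. *)
  pose i := minn (j - size s1) (maxn (size D) 1 - size s1).
  have ej' : j - size s1 = i + (j - maxn (size D) 1).
    by rewrite -{1}(subnKC s1M) subnDA minnD_subn.
  rewrite ej' in ht; move/goodP: gR.
  move/(_ _ (subseq_trans (drop_subseq s2 i) s2R)) => [_ _ /negP[]].
  exact: like_tau_drop.
(* Now the final 213 starts inside [s1]. Its last letter exceeds its first, so it cannot lie in
   [s2]: all of 213 is in [s1], and its last letter is [N] because [D] is decreasing. *)
have := @like_tau_drop j 0 (s1 ++ s2); rewrite addn0 => /(_ ht).
rewrite drop_cat js1 => h0.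
have : 0 < size (drop j s1) by rewrite size_drop subn_gt0.
have {}s12 : allrel gtn (drop j s1) s2.
  apply/allrelP => x y /mem_drop xs ys; exact: (allrelP s12).
move: (cat_take_drop j s1) s12 h0.
case: (drop j s1) => [|y [|x [|z t]]] //.
- by case: s2 {s2R R1 R2 R3 ht} => [|? [|? []]] //; rewrite /allrel /=; lia.
- by case: s2 {s2R R1 R2 R3 ht} => [|? []] //; rewrite /allrel /=; lia.
case: t s2 ht {s2R R1 R2 R3} => [|? ?] [|? ?] //; rewrite cats0 => ht e _ /= xyz _.
have e' : rcons (take j s1 ++ [:: y; x]) z = s1 by rewrite -cats1 -catA.
move: s1D; rewrite -{1}e' => /subseq_rcons_rcons[] yxD [zN|]; last first.
  rewrite rcons_cat => /(subseq_trans (suffix_subseq _ _)).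
  by move/subseq_pairwise/(_ dD) => /=; lia.
(* For [j = 0] this puts two letters in [D], against the bound on its size. For [0 < j] the first
   letter of the pattern lies in [D] and yet would exceed [N]. *)
case: j j0 js1 ht e yxD {gR e'} => [|j] /=.
  by move=> D1 _ _ _; rewrite take0 => /size_subseq /=; lia.
case: s1 {desc} => //= h s1 _ _ /andP[/allP hs _] [e].
move=> /mem_subseq/(_ h (mem_head _ _)) hD.
have /= := allP DN _ hD; have /= := hs z; rewrite -e mem_cat !inE eqxx !orbT zN.
by move/(_ isT); lia.
Qed.

(** * Words that permute an interval, and their splitting at the maximum *)

Lemma iota1Sr n : iota 1 n.+1 = rcons (iota 1 n) n.+1.
Proof. by rewrite -[n.+1 in LHS]addn1 iotaD cats1. Qed.

(** Sorting [R] and [L] separately and concatenating yields a sorted word, which must be the whole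
    interval; it is then cut at [size R]. *)
Lemma perm_iota_cat L R a :
  allrel gtn L R -> perm_eq (L ++ R) (iota a (size L + size R)) ->
  perm_eq R (iota a (size R)) /\ perm_eq L (iota (a + size R) (size L)).
Proof.
move=> /allrelP LR LRa.
have sLR : sorted leq (sort leq R ++ sort leq L).
  rewrite sorted_pairwise ?pairwise_cat; last exact: leq_trans.
  rewrite -!sorted_pairwise ?sort_sorted; do ?[exact: leq_trans|exact: leq_total].
  rewrite !andbT; apply/allrelP => x y; rewrite !mem_sort => xR yL.
  exact/ltnW/LR.
have e : sort leq R ++ sort leq L = iota a (size R + size L).
  apply: (sorted_eq leq_trans anti_leq sLR (iota_sorted _ _)).
  rewrite addnC -(permPr LRa) perm_catC.
  by apply: perm_cat; rewrite perm_sort.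
move/eqP: e; rewrite iotaD eqseq_cat ?size_sort ?size_iota // => /andP[/eqP eR /eqP eL].
by rewrite -eR -eL !(perm_sym _ (sort _ _)) !perm_sort.
Qed.

(** A letter before the maximum and a larger one after it would form 132 with the maximum. *)
Lemma avoid132_split w n :
  perm_eq w (iota 1 n.+1) -> ~~ occurs like132 w ->
  exists L R, [/\ w = L ++ n.+1 :: R, size L + size R = n, allrel gtn L R,
    perm_eq R (iota 1 (size R)) & perm_eq L (iota (size R).+1 (size L))].
Proof.
move=> wn w132; have := perm_mem wn n.+1; rewrite mem_iota.
rewrite [RHS](_ : _ = true); last by lia.
move=> nw; case/splitPr: nw wn w132 => L R wn w132; exists L, R.
have LRn : perm_eq (L ++ R) (iota 1 n).
  rewrite -(perm_cons n.+1) -cat1s perm_catCA (permPl wn) iota1Sr.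
  by rewrite perm_rcons.
have szLR : size L + size R = n by rewrite -size_cat (perm_size LRn) size_iota.
have LRlt x : x \in L ++ R -> x <= n.
  by rewrite (perm_mem LRn) mem_iota; lia.
have LR : allrel gtn L R.
  apply/allrelP => x y xL yR; rewrite /= ltnNge; apply: contra w132 => xy.
  have : uniq (L ++ R) by rewrite (perm_uniq LRn) iota_uniq.
  rewrite cat_uniq => /and3P[_ /hasPn/(_ _ yR) yL _].
  apply/occursP; exists [:: x; n.+1; y].
    apply: (cat_subseq (s1 := [:: x])); rewrite /= ?eqxx sub1seq //.
  have := LRlt y; rewrite mem_cat yR orbT => /(_ isT) yn /=.
  rewrite ltnS yn andbT ltn_neqAle xy andbT.
  by apply: contraNneq yL => <-.
by have [] := @perm_iota_cat L R 1 LR; rewrite ?szLR.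
Qed.

Lemma decr_rev_iota a l : decr (rev (iota a l)).
Proof.
have tr : transitive gtn by move=> x y z /= h1 h2; apply: ltn_trans h2 h1.
by rewrite -sorted_pairwise // rev_sorted iota_ltn_sorted.
Qed.

Lemma perm_iota_decr w a l : decr w -> perm_eq w (iota a l) -> w = rev (iota a l).
Proof.
have tr : transitive gtn by move=> x y z /= h1 h2; apply: ltn_trans h2 h1.
move=> dw wa; apply: (irr_sorted_eq tr); rewrite ?sorted_pairwise //.
- by move=> x /=; rewrite ltnn.
- exact: decr_rev_iota.
by move=> x; rewrite mem_rev (perm_mem wa).
Qed.

Lemma perm_iota_incr w a l : incr w -> perm_eq w (iota a l) -> w = iota a l.
Proof.
move=> iw wa; apply: (irr_sorted_eq ltn_trans ltnn (s2 := iota a l)).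
- by rewrite sorted_pairwise //; apply: ltn_trans.
- exact: iota_ltn_sorted.
exact: perm_mem.
Qed.

(** * Recursive enumeration of the good words *)

Definition words j n := [seq w <- permutations (iota 1 n) | good j w].

Lemma mem_words j n w : (w \in words j n) = good j w && perm_eq w (iota 1 n).
Proof. by rewrite mem_filter mem_permutations. Qed.

(** The only shape open to a good word of size [n.+1] whose maximum is not last, with [l] the number
    of letters before the maximum. *)
Definition glue n l (R : seq nat) := rev (iota (n - l).+1 l) ++ n.+1 :: R.

(** The good words whose maximum is last; for [j = 0] the rest must increase. *)
Definition words_top j n :=
  if j is 0 then [:: iota 1 n.+1] else [seq rcons w n.+1 | w <- words j n].

(** Strict upper bound for [l]: [l < n] keeps [R] nonempty, and avoiding 213 forces [l <= 1] when
    [j = 0]. *)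
Definition glue_bound j n := if j is 0 then minn n 2 else n.

Lemma index_glue n l R : l <= n -> index n.+1 (glue n l R) = l.
Proof.
move=> ln; rewrite /glue index_cat mem_rev mem_iota size_rev size_iota /= eqxx addn0.
by case: ifP => //; lia.
Qed.

Lemma glue_inj n l : injective (glue n l).
Proof. by move=> R R' /eqP; rewrite eqseq_cat // eqxx => /eqP[]. Qed.

Lemma good_glue j n l R : l <= n -> perm_eq R (iota 1 (n - l)) ->
  good j (glue n l R) = ((0 < j) || (l <= 1)) && good (j - maxn l 1) R.
Proof.
move=> ln Rn; rewrite /glue good_cat ?size_rev ?size_iota ?decr_rev_iota //.
  by apply/allP => x; rewrite mem_rev mem_iota /=; lia.
apply/allrelP => x y; rewrite (perm_mem Rn) mem_rcons inE mem_rev !mem_iota /=.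
lia.
Qed.

(** The union is disjoint: words of the first kind end in [n.+1], glued words do not since [R] is
    nonempty, and [l] is recovered as the index of [n.+1]. *)
Lemma words_rec j n :
  perm_eq (words j n.+1)
    (words_top j n ++ [seq glue n l R | l <- iota 0 (glue_bound j n),
                                        R <- words (j - maxn l 1) (n - l)]).
Proof.
have bn l : l \in iota 0 (glue_bound j n) = (l < n) && ((0 < j) || (l <= 1)).
  by rewrite mem_iota /glue_bound; case: (j) => [|?]; lia.
apply: uniq_perm.
- exact/filter_uniq/permutations_uniq.
- rewrite cat_uniq; apply/and3P; split.
  + rewrite /words_top; case: (j) => //= j'; rewrite map_inj_uniq.
      exact/filter_uniq/permutations_uniq.
    exact: rcons_injl.
  + apply/hasPn => _ /allpairsPdep[l [R [+ + ->]]].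
    rewrite bn mem_words => /andP[ln _] /andP[_ Rn].
    have : last n.+1 (glue n l R) != n.+1.
      rewrite /glue last_cat /=; case/lastP: R Rn => [|R x] Rn.
        by move/perm_size: Rn; rewrite size_iota /=; lia.
      have := perm_mem Rn x; rewrite last_rcons mem_rcons mem_head mem_iota; lia.
    apply: contra; rewrite /words_top; case: (j) => [|j'].
      by rewrite inE => /eqP->; rewrite iota1Sr last_rcons.
    by case/mapP=> w _ ->; rewrite last_rcons.
  apply: allpairs_uniq_dep => [|l _|]; first exact: iota_uniq.
    exact/filter_uniq/permutations_uniq.
  move=> _ _ /allpairsPdep[l [R [+ _ ->]]] /allpairsPdep[l' [R' [+ _ ->]]] /=.
  rewrite !bn => /andP[ln _] /andP[ln' _] e.
  have el : l = l' by rewrite -(@index_glue n l R) ?(ltnW ln) // e index_glue // ltnW.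
  by rewrite -el in e *; rewrite (glue_inj e).
move=> w; rewrite mem_words mem_cat; apply/andP/orP.
- move=> [gw wn]; have /and3P[w132 _ _] := gw.
  have [L [R [ew sLR LR Rn Ln]]] := avoid132_split wn w132.
  have LN : all (gtn n.+1) L.
    by apply/allP => x; rewrite (perm_mem Ln) mem_iota /=; lia.
  have uL : uniq L by rewrite (perm_uniq Ln) iota_uniq.
  have [R0|R0] := eqVneq R [::].
    left; rewrite R0 in ew sLR Ln; rewrite addn0 in sLR.
    rewrite cats1 in ew; rewrite /= sLR in Ln; rewrite ew in gw *.
    rewrite /words_top; case: j gw {bn} => [|j'] gw.
      have iL := good0_rcons_incr uL LN gw.
      by rewrite inE (perm_iota_incr iL Ln) iota1Sr.
    by apply/mapP; exists L => //; rewrite mem_words Ln andbT -(good_rcons (N := n.+1)).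
  right; have dL : decr L by rewrite ew in gw; apply: good_left_decr gw.
  have sR : size R = n - size L by lia.
  have ew' : w = glue n (size L) R.
    by rewrite ew /glue {1}(perm_iota_decr dL Ln) sR.
  rewrite sR in Rn; have Ln' : size L < n by case: (R) R0 sLR => //= ? ?; lia.
  rewrite ew' good_glue ?(ltnW Ln') // in gw; case/andP: gw => jL gR.
  apply/allpairsPdep; exists (size L), R; split=> //; first by rewrite bn Ln'.
  by rewrite mem_words gR.
case.
  rewrite /words_top; case: (j) => [|j'].
    rewrite inE => /eqP->; split=> //; apply: good_incr.
    by rewrite -sorted_pairwise ?iota_ltn_sorted //; apply: ltn_trans.
  case/mapP => v; rewrite mem_words => /andP[gv vn] ->; split.
    by rewrite good_rcons //; apply/allP => x; rewrite (perm_mem vn) mem_iota /=; lia.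
  by rewrite iota1Sr -!cats1 perm_cat2r.
case/allpairsPdep=> l [R [+ + ->]]; rewrite bn mem_words => /andP[ln jl] /andP[gR Rn].
split; first by rewrite good_glue ?(ltnW ln) // jl.
rewrite iota1Sr -cats1 /glue -cat1s perm_catCA perm_sym perm_catC perm_cat2l.
rewrite perm_sym perm_catC -{2}(subnK (ltnW ln)) iotaD.
by apply: perm_cat; rewrite ?perm_rev.
Qed.

Definition num j n := size (words j n).

Lemma num0S n : num 0 n.+1 = (1 + \sum_(l < minn n 2) num 0 (n - l))%N.
Proof.
rewrite /num (perm_size (words_rec _ _)) size_cat size_allpairs_dep.
rewrite sumnE big_map -(big_mkord xpredT (fun l => num 0 (n - l))) /index_iota subn0.
by [].
Qed.

Lemma numS j n : 0 < j ->
  num j n.+1 = (num j n + \sum_(l < n) num (j - maxn l 1) (n - l))%N.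
Proof.
case: j => // j _; rewrite /num (perm_size (words_rec _ _)) size_cat size_allpairs_dep.
rewrite sumnE big_map size_map.
rewrite -(big_mkord xpredT (fun l => num (j.+1 - maxn l 1) (n - l))).
by rewrite /index_iota subn0.
Qed.

(** * From permutations and pattern containment to words *)

Definition order_iso (s q : seq nat) :=
  (size s == size q) &&
  all2rel (fun x y : nat * nat => (x.1 < y.1) == (x.2 < y.2)) (zip s q).

Lemma order_isoP (s q : seq nat) :
  reflect (size s = size q /\ forall a b, a < size q -> b < size q ->
             (nth 0 s a < nth 0 s b) = (nth 0 q a < nth 0 q b))
          (order_iso s q).
Proof.
apply: (iffP andP) => [[/eqP ssq /allrelP H]|[ssq H]].
  split=> // a b aq bq; have := H (nth (0, 0) (zip s q) a) (nth (0, 0) (zip s q) b).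
  rewrite !nth_zip //= => /(_ _ _)/eqP; apply.
    by rewrite -nth_zip // mem_nth // size1_zip ssq.
  by rewrite -nth_zip // mem_nth // size1_zip ssq.
split; first exact/eqP.
apply/allrelP => _ _ /(nthP (0, 0))[a + <-] /(nthP (0, 0))[b + <-].
by rewrite !size1_zip ?ssq // => aq bq; rewrite !nth_zip //= H.
Qed.

(** Removing a leading maximum from the pattern is the induction step that matches [tau_word] with
    the recursion of [like_tau]. *)
Lemma order_iso_cons x s y q :
  all (gtn y) q -> order_iso (x :: s) (y :: q) = all (gtn x) s && order_iso s q.
Proof.
move=> /(all_nthP 0) /= yq.
apply/order_isoP/andP => /= [[[ssq] H]|[/(all_nthP 0) /= xs /order_isoP[ssq H]]].
  split; last by apply/order_isoP; split=> // a b aq bq; apply: (H a.+1 b.+1).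
  apply/(all_nthP 0) => i; rewrite ssq => iq /=.
  by have /= -> := H i.+1 0 iq isT; apply: yq.
split=> [|[|a] [|b]] /=; rewrite ?ssq ?ltnn ?ltnS // in xs * => aq bq; last exact: H.
  by rewrite ltnNge (ltnW (xs _ bq)) ltnNge (ltnW (yq _ bq)).
by rewrite (xs _ aq) (yq _ aq).
Qed.

Lemma order_iso132 s : order_iso s [:: 1; 3; 2] = like132 s.
Proof.
case: s => [|x [|y [|z []]]] //.
by rewrite /order_iso /allrel /=; lia.
Qed.

Lemma order_iso2341 s : order_iso s [:: 2; 3; 4; 1] = like2341 s.
Proof.
case: s => [|x [|y [|z [|t []]]]] //.
by rewrite /order_iso /allrel /=; lia.
Qed.

Lemma tau_wordS j : tau_word (j.+1 + 3) = (j + 4) :: tau_word (j + 3).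
Proof. by rewrite /tau_word !addnK -[j.+1]addn1 iotaD rev_cat /= (addnC 4). Qed.

Lemma order_iso_tau j s : order_iso s (tau_word (j + 3)) = like_tau j s.
Proof.
elim: j s => [|j IH] s.
  by case: s => [|x [|y [|z []]]] //; rewrite /order_iso /allrel /=; lia.
rewrite tau_wordS; case: s => // h s; rewrite order_iso_cons ?IH //.
apply/allP => x; rewrite (perm_mem (tau_word_perm _)) ?leq_addl // mem_iota /=; lia.
Qed.

Lemma oneline_nth n (p : 'S_n) (i : 'I_n) : nth 0 (oneline p) i = (p i).+1.
Proof. by rewrite (nth_map i) ?size_enum_ord // nth_ord_enum. Qed.

Lemma size_oneline n (p : 'S_n) : size (oneline p) = n.
Proof. by rewrite size_map size_enum_ord. Qed.

Lemma sorted_enum_ord n : sorted (fun i j : 'I_n => i < j) (enum 'I_n).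
Proof.
by have := iota_ltn_sorted 0 n; rewrite -val_enum_ord sorted_map.
Qed.

(** Increasing maps into ['I_n] correspond to masks of [enum 'I_n], and [oneline] carries these to
    subsequences of the word. *)
Lemma contains_occurs n m (p : 'S_n) (q : 'S_m) :
  contains p q = occurs (fun s => order_iso s (oneline q)) (oneline p).
Proof.
pose lt (N : nat) := fun i j : 'I_N => i < j.
have lt_tr N : transitive (lt N) by move=> x y z; apply: ltn_trans.
have lt_irr N : irreflexive (lt N) by move=> x; apply: ltnn.
apply/existsP/occursP => [[f /andP[/forallP fh /forallP fp]]|[s /subseqP[b _ ->]]].
  have {}fh (a b : 'I_m) : a < b -> f a < f b by have /forallP/(_ b)/implyP := fh a.
  exists [seq (p (f i)).+1 | i <- enum 'I_m].
    rewrite (map_comp (fun x => (p x).+1) f); apply: map_subseq.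
    (* Both sides are strictly increasing lists with the same elements. *)
    have -> : map f (enum 'I_m) = filter (mem (map f (enum 'I_m))) (enum 'I_n).
      apply: (irr_sorted_eq (lt_tr n) (lt_irr n)).
      - apply: homo_sorted (sorted_enum_ord m) => x y; exact: fh.
      - exact/(sorted_filter (lt_tr n))/sorted_enum_ord.
      by move=> x; rewrite mem_filter mem_enum andbT.
    exact: filter_subseq.
  have fE (i : 'I_m) : nth 0 [seq (p (f i)).+1 | i <- enum 'I_m] i = (p (f i)).+1.
    by rewrite (nth_map i) ?size_enum_ord // nth_ord_enum.
  apply/order_isoP; rewrite size_oneline size_map size_enum_ord.
  split=> // a b am bm; have := fE (Ordinal bm); have := fE (Ordinal am).
  have := oneline_nth q (Ordinal bm); have := oneline_nth q (Ordinal am).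
  move=> /= -> -> -> ->; rewrite !ltnS.
  by have /forallP/(_ (Ordinal bm))/eqP := fp (Ordinal am).
rewrite [oneline p]/oneline -map_mask => /order_isoP[]; set t := mask _ _.
rewrite size_map size_oneline => st tq.
have tt : sorted (@lt n) t by apply/(sorted_mask (lt_tr n))/sorted_enum_ord.
exists [ffun a => tnth (Tuple (introT eqP st)) a].
have tE x0 (a : 'I_m) : tnth (Tuple (introT eqP st)) a = nth x0 t a.
  by rewrite (tnth_nth x0).
apply/andP; split; apply/forallP => a; apply/forallP => c; rewrite !ffunE;
  have x0 := tnth (Tuple (introT eqP st)) a.
  apply/implyP => ac; rewrite !(tE x0).
  have := sorted_ltn_nth (lt_tr n) x0 tt; move=> /(_ a c).
  by rewrite !inE st => /(_ (ltn_ord a) (ltn_ord c) ac).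
have := tq a c (ltn_ord a) (ltn_ord c); rewrite !oneline_nth !ltnS => <-.
rewrite !(nth_map x0) ?st //.
by rewrite -!(tE x0).
Qed.

Lemma oneline_inj n : injective (@oneline n).
Proof.
move=> p q e; apply/permP => i; apply: val_inj; apply: succn_inj.
by rewrite -!oneline_nth e.
Qed.

Lemma perm_oneline n (p : 'S_n) : perm_eq (oneline p) (iota 1 n).
Proof.
rewrite (_ : iota 1 n = map (succn \o val) (enum 'I_n)); last first.
  by rewrite map_comp val_enum_ord -[1]addn0 iotaDl.
rewrite /oneline (map_comp (succn \o val) p); apply: perm_map.
apply: uniq_perm; rewrite ?enum_uniq // ?(map_inj_uniq perm_inj) ?enum_uniq //.
by move=> x; rewrite mem_enum -[x](permKV p) map_f // mem_enum.
Qed.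

Lemma eq_occurs (T : eqType) (P Q : pred (seq T)) w :
  P =1 Q -> occurs P w = occurs Q w.
Proof. by move=> PQ; apply: eq_existsb => m; apply: PQ. Qed.

Lemma card_avoiders j n :
  #|avoiders n [:: Pattern perm132; Pattern (tau (j + 3)); Pattern perm2341]|
  = num j n.
Proof.
rewrite /num cardE -(size_map (@oneline n)); apply/perm_size/uniq_perm.
- by rewrite (map_inj_uniq (@oneline_inj n)) enum_uniq.
- exact/filter_uniq/permutations_uniq.
have gE (p : 'S_n) : (p \in avoiders n
    [:: Pattern perm132; Pattern (tau (j + 3)); Pattern perm2341]) = good j (oneline p).
  rewrite inE /= !contains_occurs /= andbT /good; congr [&& ~~ _ & _];
    last rewrite andbC; do ?congr (~~ _ && ~~ _).
  - by apply: eq_occurs => s; rewrite perm_of_onelineK // order_iso132.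
  - by apply: eq_occurs => s; rewrite perm_of_onelineK // order_iso2341.
  apply: eq_occurs => s; rewrite perm_of_onelineK ?order_iso_tau //.
  by apply: tau_word_perm; rewrite leq_addl.
move=> w; rewrite mem_words; apply/mapP/andP => [[p +->]|[gw wn]].
  by rewrite mem_enum gE perm_oneline.
by exists (perm_of_oneline n w); rewrite ?mem_enum ?gE perm_of_onelineK.
Qed.

(** * Fibonacci combinations plus a polynomial: shifts and discrete integration *)

Import Order.TTheory GRing.Theory Num.Theory.
Local Open Scope ring_scope.

(* [c] is the coefficient of degree [d] of [p]; it may be zero. *)
Definition fib_poly d c N (f : nat -> rat) :=
  exists (a b : rat) (p : {poly rat}),
    [/\ (size p <= d.+1)%N, p`_d = c &
        forall n, (N <= n)%N -> f n = a * (fib n)%:R + b * (fib n.+1)%:R + p.[n%:R]].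

Lemma fibSS n : fib n.+2 = (fib n.+1 + fib n)%N.
Proof. by []. Qed.

Lemma eq_fib_poly d c N f g :
  (forall n, (N <= n)%N -> f n = g n) -> fib_poly d c N f -> fib_poly d c N g.
Proof.
by move=> fg [a [b [p [sp pd H]]]]; exists a, b, p; split=> // n Nn; rewrite -fg ?H.
Qed.

Lemma fib_poly_leN d c N M f : (N <= M)%N -> fib_poly d c N f -> fib_poly d c M f.
Proof.
move=> NM [a [b [p [sp pd H]]]]; exists a, b, p; split=> // n Mn.
exact/H/(leq_trans NM).
Qed.

Lemma fib_poly_ltd d e c N f : (d < e)%N -> fib_poly d c N f -> fib_poly e 0 N f.
Proof.
move=> de [a [b [p [sp pd H]]]]; exists a, b, p; split=> //.
  exact/(leq_trans sp)/ltnW.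
by apply/nth_default/(leq_trans sp).
Qed.

Lemma fib_polyD d c c' N f g : fib_poly d c N f -> fib_poly d c' N g ->
  fib_poly d (c + c') N (fun n => f n + g n).
Proof.
move=> [a [b [p [sp pd H]]]] [a' [b' [p' [sp' pd' H']]]].
exists (a + a'), (b + b'), (p + p'); split=> [||n Nn].
- by rewrite (leq_trans (size_polyD _ _)) // geq_max sp.
- by rewrite coefD pd pd'.
by rewrite H // H' // hornerD; ring.
Qed.

Lemma fib_poly0 d N : fib_poly d 0 N (fun=> 0).
Proof.
by exists 0, 0, 0; split=> [||n _]; rewrite ?size_poly0 ?coef0 ?horner0 //; ring.
Qed.

Lemma fib_poly_sum d N (I : finType) (P : pred I) (F : I -> nat -> rat) :
  (forall i, P i -> fib_poly d 0 N (F i)) ->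
  fib_poly d 0 N (fun n => \sum_(i | P i) F i n).
Proof.
move=> H; elim: (index_enum I) => [|i r IH].
  by apply: eq_fib_poly (fib_poly0 d N) => n _; rewrite big_nil.
case Pi: (P i); last by apply: eq_fib_poly IH => n _; rewrite big_cons Pi.
rewrite -(addr0 0); apply: eq_fib_poly (fib_polyD (H i Pi) IH) => n _.
by rewrite big_cons Pi.
Qed.

Lemma coef_comp_XsubC (p : {poly rat}) d x :
  (size p <= d.+1)%N -> (p \Po ('X - x%:P))`_d = p`_d.
Proof.
move=> sp; have [sd|sd] := leqP (size p) d.
  by rewrite !nth_default // (size_comp_poly2 _ (size_XsubC _)).
have ed : d = (size p).-1 by rewrite (@anti_leq (size p) d.+1) // sp.
rewrite {1}ed -(size_comp_poly2 p (size_XsubC x)) -lead_coefE.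
by rewrite lead_coef_comp ?size_XsubC // lead_coefXsubC expr1n mulr1 lead_coefE -ed.
Qed.

Lemma fib_poly_shift1 d c N f :
  fib_poly d c N f -> fib_poly d c N.+1 (fun n => f n.-1).
Proof.
(* The coefficients come from F_(n-1) = F_(n+1) - F_n. *)
move=> [a [b [p [sp pd H]]]]; exists (b - a), a, (p \Po ('X - 1%:P)); split.
- by rewrite (size_comp_poly2 _ (size_XsubC _)).
- by rewrite coef_comp_XsubC.
case=> // n Nn; rewrite H // horner_comp !hornerE fibSS natrD -natr1 addrK.
by ring.
Qed.

Lemma fib_poly_shift i d c N f :
  fib_poly d c N f -> fib_poly d c (N + i) (fun n => f (n - i)%N).
Proof.
move=> H; elim: i => [|i IH].
  by rewrite addn0; apply: eq_fib_poly H => n _; rewrite subn0.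
rewrite addnS; apply: eq_fib_poly (fib_poly_shift1 IH) => n _.
by congr f; lia.
Qed.

Lemma coef_X1n (R : nzRingType) n i : (('X + 1 : {poly R}) ^+ n)`_i = 'C(n, i)%:R.
Proof.
have -> : ('X + 1) ^+ n = \poly_(k < n.+1) ('C(n, k)%:R : R).
  by rewrite exprD1n poly_def; apply: eq_bigr => k _; rewrite scaler_nat.
rewrite coef_poly ltnS; case: leqP => // ni.
by rewrite bin_small.
Qed.

(** Induction on the degree: the difference of X^(d+2) / (d+2) has leading term X^(d+1), so a
    multiple of it removes the top term of [p]. *)
Lemma poly_antidiff d (p : {poly rat}) : (size p <= d.+1)%N ->
  exists P : {poly rat}, [/\ (size P <= d.+2)%N, P`_d.+1 = p`_d / d.+1%:R &
    P \Po ('X + 1) - P = p].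
Proof.
elim: d p => [|d IH] p sp.
  exists (p`_0 *: 'X); split.
  - by rewrite (leq_trans (size_scale_leq _ _)) ?size_polyX.
  - by rewrite coefZ coefX /= [RHS]divr1 mulr1.
  by rewrite comp_polyZ comp_polyX -scalerBr addrC addKr alg_polyC -size1_polyC.
pose q : {poly rat} := (p`_d.+1 / d.+2%:R) *: 'X^(d.+2).
pose r := p - (q \Po ('X + 1) - q).
have sr : (size r <= d.+1)%N.
  apply/leq_sizeP => i di.
  rewrite 2!coefB /q comp_polyZ comp_Xn_poly !coefZ coef_X1n coefXn -mulrBr.
  move: di; rewrite leq_eqVlt => /orP[/eqP<-|di].
    by rewrite binSn ltn_eqF // subr0 -mulrA mulVf ?pnatr_eq0 // mulr1 subrr.
  rewrite nth_default ?(leq_trans sp) //; have [->|ni] := eqVneq i d.+2.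
    by rewrite binn subrr mulr0 subrr.
  by rewrite bin_small ?subrr ?mulr0 ?subrr //; lia.
have [P [sP Pd PE]] := IH r sr.
exists (q + P); split.
- rewrite (leq_trans (size_polyD _ _)) // geq_max (leq_trans sP) // andbT.
  by rewrite (leq_trans (size_scale_leq _ _)) ?size_polyXn.
- by rewrite coefD coefZ coefXn eqxx mulr1 [P`__]nth_default ?addr0.
by rewrite comp_polyD opprD addrACA PE /r addrC subrK.
Qed.

Lemma fib_poly_antidiff d c N f g : fib_poly d c N g ->
  (forall n, (N <= n)%N -> f n.+1 = f n + g n) ->
  fib_poly d.+1 (c / d.+1%:R) N f.
Proof.
move=> [a [b [p [sp pd H]]]] fS.
have [P [sP Pd PE]] := poly_antidiff sp.
(* The forward differences of F_n and F_(n+1) are F_(n+1) - F_n and F_n, which gives these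
   coefficients. Then [f] and [h] differ by a constant, absorbed into the polynomial without
   touching degree [d.+1]. *)
pose h n := b * (fib n)%:R + (a + b) * (fib n.+1)%:R + P.[n%:R].
have hS n : (N <= n)%N -> h n.+1 = h n + g n.
  move=> Nn; rewrite H // /h -PE.
  rewrite !(hornerD, hornerN, horner_comp, hornerX, hornerC) -natr1.
  by rewrite !fibSS !natrD; ring.
exists b, (a + b), (P + (f N - h N)%:P); split.
- rewrite (leq_trans (size_polyD _ _)) // geq_max sP.
  exact: leq_trans (size_polyC_leq1 _) _.
- by rewrite coefD coefC addr0 Pd pd.
move=> n Nn; rewrite hornerD hornerC addrA -/(h n).
rewrite -(subnKC Nn); elim: (n - N)%N => [|m IH].
  by rewrite addn0; ring.
by rewrite addnS fS ?leq_addr // hS ?leq_addr // IH; ring.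
Qed.

Local Close Scope ring_scope.

(** * Solving the recurrences *)

Lemma fibS_gt0 n : 0 < fib n.+1.
Proof. by elim: n => // n IH; rewrite fibSS ltn_addr. Qed.

(** From size 3 on the recurrence is x_(n+2) = x_(n+1) + x_n + 1, so x_n + 1 satisfies the Fibonacci
    recurrence. *)
Lemma num0E n : num 0 n.+1 = (fib n.+3).-1.
Proof.
suff: num 0 n.+1 = (fib n.+3).-1 /\ num 0 n.+2 = (fib n.+4).-1 by case.
elim: n => [|n [IH1 IH2]].
  have num1 : num 0 1 = 1 by rewrite num0S min0n big_ord0.
  by rewrite num1 num0S (_ : minn 1 2 = 1) // big_ord1 subn0 num1.
split=> //; rewrite num0S (_ : minn _ 2 = 2); last by lia.
have -> : \sum_(l < 2) num 0 (n.+2 - l) = num 0 n.+2 + num 0 n.+1.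
  by rewrite !big_ord_recl big_ord0 addn0.
rewrite IH1 IH2.
rewrite (fibSS n.+3); have := fibS_gt0 n.+2; have := fibS_gt0 n.+3; lia.
Qed.

Local Open Scope ring_scope.

Definition numr j n : rat := (num j n)%:R.

(** The threshold is 1 because the empty word gives [num 0 0 = 1], while F_2 - 1 = 0. *)
Lemma fib_poly_num0 : fib_poly 0 (-1) 1 (numr 0).
Proof.
exists 1, 1, (- 1%:P); split=> [||[] // n _].
- by rewrite size_polyN size_polyC_leq1.
- by rewrite coefN coefC.
rewrite /numr num0E hornerN hornerC !mul1r -natrD addnC -fibSS.
by case: (fib n.+3) (fibS_gt0 n.+2) => // m _; rewrite /= -natr1 addrK.
Qed.

Lemma fib_poly_sum_num0 : fib_poly 1 (-1) 0 (fun n => \sum_(m < n) numr 0 m.+1).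
Proof.
have -> : -1 = -1 / 1%:R :> rat by rewrite divr1.
apply: (@fib_poly_antidiff _ _ _ _ (fun n => numr 0 n.+1)); last first.
  by move=> n _; rewrite big_ord_recr.
have [a [b [p [sp pd H]]]] := fib_poly_num0.
exists b, (a + b), (p \Po ('X - (-1)%:P)); split.
- by rewrite (size_comp_poly2 _ (size_XsubC _)).
- by rewrite coef_comp_XsubC.
move=> n _; rewrite H // horner_comp !hornerE opprK natr1 fibSS natrD.
by ring.
Qed.

Lemma numrS j n : (0 < j)%N ->
  numr j n.+1 = numr j n + \sum_(l < n) numr (j - maxn l 1) (n - l).
Proof. by move=> j0; rewrite /numr numS // natrD natr_sum. Qed.

(** For [l >= j] the index [j - maxn l 1] is 0; these terms are then summed in reverse order. *)
Lemma sum_num_split j n : (0 < j)%N -> (j <= n)%N ->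
  \sum_(l < n) numr (j - maxn l 1) (n - l) =
  \sum_(l < j) numr (j - maxn l 1) (n - l) + \sum_(m < n - j) numr 0 m.+1.
Proof.
move=> j0 jn; rewrite -!(big_mkord xpredT (fun l => numr (j - maxn l 1) (n - l))).
rewrite (big_cat_nat _ jn) //=; congr (_ + _).
rewrite -{1}[j]add0n big_addn big_mkord (reindex_inj rev_ord_inj) /=.
by apply: eq_bigr => m _; congr numr; have := ltn_ord m; lia.
Qed.

(** The sign of the top coefficient is part of the induction, so that the two contributions to it
    cannot cancel. *)
Lemma fib_poly_num j : (0 < j)%N -> exists2 c, c < 0 & fib_poly j.+1 c j.+2 (numr j).
Proof.
elim/ltn_ind: j => j IH j0.
suff [c c0 H] : exists2 c, c < 0 &
    fib_poly j c j.+2 (fun n => \sum_(l < n) numr (j - maxn l 1) (n - l)).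
  exists (c / j.+1%:R); first by rewrite pmulr_llt0 // invr_gt0 ltr0n.
  by apply: fib_poly_antidiff H _ => n _; rewrite numrS.
have tail := fib_poly_shift j fib_poly_sum_num0; rewrite add0n in tail.
(* For [j = 1] every summand is a value of [num 0], which gives the top coefficient -1. *)
have [j1|j1] := eqVneq j 1%N.
  exists (-1); first by [].
  rewrite j1; apply: eq_fib_poly (fib_poly_leN (leq0n _) fib_poly_sum_num0) => n _.
  rewrite [RHS](reindex_inj rev_ord_inj) /=.
  by apply: eq_bigr => m _; congr numr; have := ltn_ord m; lia.
have jgt1 : (1 < j)%N by lia.
have [c c0 Hc] : exists2 c, c < 0 & fib_poly j c j.+1 (numr j.-1).
  have [||c c0 Hc] := IH j.-1; [lia|lia|].
  by rewrite prednK // in Hc; exists c.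
(* The terms [l = 0] and [l = 1] both involve [numr j.-1], each with top coefficient [c]. *)
exists (c + c); first lra.
have T0 : fib_poly j 0 j.+2 (fun n => \sum_(m < n - j) numr 0 m.+1).
  by apply: (@fib_poly_ltd 1 _ (-1)) => //; apply: fib_poly_leN tail; lia.
(* For [l > 1] the degree is [j - l + 1 < j], and the threshold [j - l + 2], shifted by [l], becomes
   [j + 2]. *)
have T1 : fib_poly j 0 j.+2 (fun n =>
    \sum_(l < j | (1 < l)%N) numr (j - maxn l 1) (n - l)).
  apply: fib_poly_sum => l l1.
  have lj := ltn_ord l.
  have [||c' _ Hl] := IH (j - maxn l 1)%N; [lia|lia|].
  apply: (fib_poly_ltd _ (fib_poly_leN _ (fib_poly_shift l Hl))); lia.
have T2 : fib_poly j (c + c) j.+2 (fun n => numr j.-1 n + numr j.-1 (n - 1)%N).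
  apply: fib_polyD; first exact: fib_poly_leN Hc.
  by rewrite -addn1; apply: fib_poly_shift.
rewrite -[c + c]addr0 -[_ + _ + 0]addr0.
apply: eq_fib_poly (fib_polyD (fib_polyD T2 T1) T0) => n jn.
rewrite sum_num_split //; last lia.
congr (_ + _); rewrite big_mkcond /=.
have [i ->] : exists i, j = i.+2 by exists j.-2; lia.
rewrite 2!big_ord_recl [RHS]big_ord_recl [in RHS]big_ord_recl /= subn0 !add0r addrA.
by congr (_ + _ + _).
Qed.

Theorem theorem4p13 (k : nat) (hk : (4 <= k)%N) :
  exists (a b : rat) (r s : int) (p : {poly rat}),
    size p = (k - 2).+1 /\
    forall n : nat, (k <= n)%N ->
      #|avoiders n [:: Pattern perm132; Pattern (tau k); Pattern perm2341]|%:R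
      = a * (fibz (n%:Z + r))%:~R + b * (fibz (n%:Z + s))%:~R + p.[n%:R].
Proof.
have [c c0 [a [b [p [sp pd H]]]]] := @fib_poly_num (k - 3) ltac:(lia).
(* With [j = k - 3] the formula holds from [j + 2 = k - 1] on; the size of [p] is exact because its
   coefficient of degree [j + 1 = k - 2] is [c < 0]. *)
exists a, b, 0, 1, p; split.
  apply/eqP; rewrite eqn_leq; apply/andP; split; first by apply: leq_trans sp _; lia.
  rewrite ltnNge; apply: contraTN c0 => sp'.
  by rewrite -pd nth_default ?ltxx //; apply: leq_trans sp' _; lia.
move=> n kn; have := card_avoiders (k - 3) n; rewrite subnK ?(ltnW hk) // => ->.
by rewrite -/(numr _ _) H ?addr0 -?PoszD ?addn1 //; lia.
Qed.
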